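(* Let $(X,d)$ and $(Y,\rho)$ be two complete metric spaces, and let $T:X\times Y\to X$ and $S:X\times Y\to Y$ be extended jointly $(\psi,\phi)$-contractions, where $\psi,\phi:(0,\infty)\to\mathbb{R}$. Suppose that: (i) $\phi(t)<\psi(t)$ for any $t>0$; (ii) $\inf_{t>\epsilon}\psi(t)>-\infty$ for any $\epsilon>0$; (iii) if $\{\psi(t_n)\}$ and $\{\phi(t_n)\}$ are convergent sequences with the same limit and $\{\psi(t_n)\}$ is strictly decreasing, then $t_n\to0$ as $n\to\infty$; (iv) $\limsup_{t\to\epsilon+}\phi(t)<\liminf_{t\to\epsilon+}\psi(t)$ for any $\epsilon>0$; (v) $T$ and $S$ have closed graphs, or $\limsup_{t\to0+}\phi(t)<\min\{\liminf_{t\to\epsilon}\psi(t),\psi(\epsilon)\}$ for any $\epsilon>0$. Then there exists a unique point $\xi^*=(x^*,y^* )\in X\times Y$ such that $x^*=T(x^*,y^* )$ and $y^*=S(x^*,y^* )$, and the sequences $x_n=T^n(x,y)$ and $y_n=S^n(x,y)$ converge to $x^*$ and $y^*$ respectively for any $(x,y)\in X\times Y$.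
   Context: Maps $T:X\times Y\to X$ and $S:X\times Y\to Y$ are extended jointly $(\psi,\phi)$-contractions, where $\psi,\phi:(0,\infty)\to\mathbb{R}$ are functions such that $\phi(t)<\psi(t)$ for every $t>0$, if for all $z=(x,y)$, $w=(u,v)$ in $X\times Y$ with $\max\{d(T(x,y),T(u,v)),\rho(S(x,y),S(u,v))\}>0$, both $\psi(d(Tz,Tw))\le\phi(\max\{d(x,u),\rho(y,v)\})$ and $\psi(\rho(Sz,Sw))\le\phi(\max\{d(x,u),\rho(y,v)\})$ hold. The iterates are defined by $T^1=T$, $S^1=S$, and for $n\ge2$, $T^n(x,y)=T\big(T^{n-1}(x,y),S^{n-1}(x,y)\big)$, $S^n(x,y)=S\big(T^{n-1}(x,y),S^{n-1}(x,y)\big)$. In (iii), $\{t_n\}$ is a sequence in $(0,\infty)$. A map $f$ on $X\times Y$ has a closed graph if $x_n\to x$, $y_n\to y$ and $f(x_n,y_n)\to\alpha$ imply $f(x,y)=\alpha$. *)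

(* Defs.v *)
From HB Require Import structures.
From mathcomp Require Import all_boot all_order all_algebra.
From mathcomp Require Import all_classical all_reals all_analysis.

Set Implicit Arguments.
Unset Strict Implicit.
Unset Printing Implicit Defensive.

Import Order.TTheory GRing.Theory Num.Theory.
Import numFieldNormedType.Exports.

Local Open Scope classical_set_scope.
Local Open Scope ring_scope.

(* As [completeType] is pointed, these spaces are nonempty; the existence of a
   fixed point would fail in an empty space. *)
#[short(type="completeMetricType")]
HB.structure Definition CompleteMetric (R : numDomainType) :=
  {T of CompletePseudoMetric R T & Metric R T}.

(* The functions on the open half-line are total here, but their values outside
   of it are irrelevant: each of the two inequalities is required only when the
   argument of [psi] is positive. The argument of [phi] is then positive too. *)
Definition extended_jointly_contraction (R : realType) (X Y : metricType R)
    (psi phi : R -> R) (T : X * Y -> X) (S : X * Y -> Y) : Prop :=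
  forall z w : X * Y,
    0 < Num.max (mdist (T z) (T w)) (mdist (S z) (S w)) ->
    (0 < mdist (T z) (T w) ->
       psi (mdist (T z) (T w)) <=
       phi (Num.max (mdist z.1 w.1) (mdist z.2 w.2))) /\
    (0 < mdist (S z) (S w) ->
       psi (mdist (S z) (S w)) <=
       phi (Num.max (mdist z.1 w.1) (mdist z.2 w.2))).

(* [Titer T S n] and [Siter T S n] are $T^n$ and $S^n$ for n > 0, extended by
   the two projections at n = 0. *)
Fixpoint Titer (X Y : Type) (T : X * Y -> X) (S : X * Y -> Y) (n : nat)
    (z : X * Y) {struct n} : X :=
  if n is m.+1 then T (Titer T S m z, Siter T S m z) else z.1
with Siter (X Y : Type) (T : X * Y -> X) (S : X * Y -> Y) (n : nat)
    (z : X * Y) {struct n} : Y :=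
  if n is m.+1 then S (Titer T S m z, Siter T S m z) else z.2.

Definition closed_graph (X Y Z : topologicalType) (f : X * Y -> Z) : Prop :=
  forall (x_ : nat -> X) (y_ : nat -> Y) (x : X) (y : Y) (a : Z),
    x_ n @[n --> \oo] --> x -> y_ n @[n --> \oo] --> y ->
    f (x_ n, y_ n) @[n --> \oo] --> a -> f (x, y) = a.

(* Main.v *)
(** For the max-distance on [X * Y], the map [F := (T, S)] satisfies
    [psi (d (F z) (F w)) <= phi (d z w)]. By (i)-(iii) the distance between any
    two orbits tends to 0; this gives uniqueness, and reduces the convergence of
    all orbits to that of one of them. An orbit that is not Cauchy would have
    points whose distance decreases to 0 in small steps from a value above some
    [eps > 0], hence two consecutive distances just above [eps], against (iv).
    Finally, (v) makes the limit of an orbit a fixed point. *)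
Require Import Defs.
From mathcomp Require Import all_boot all_order all_algebra.
From mathcomp Require Import all_classical all_reals all_analysis.
From HB Require Import structures.
From mathcomp Require Import lra.
Import Order.TTheory GRing.Theory Num.Theory.
Import numFieldNormedType.Exports.
Local Open Scope classical_set_scope.
Local Open Scope ring_scope.

(** * The max-distance on the product *)

Section product_metric.
Context {R : realType} {X Y : metricType R}.

Definition prod_mdist (z w : X * Y) : R :=
  Num.max (mdist z.1 w.1) (mdist z.2 w.2).

Fact prod_mdist_ge0 z w : 0 <= prod_mdist z w.
Proof. by rewrite le_max mdist_ge0. Qed.

Fact prod_mdist_positivity z w : prod_mdist z w = 0 -> z = w.
Proof.
case: z w => [x y] [u v] d0; have : prod_mdist (x, y) (u, v) <= 0 by rewrite d0.
rewrite ge_max !le_eqVlt !ltNge !mdist_ge0 !orbF => /andP[/eqP xu /eqP yv].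
by congr pair; exact: mdist_positivity.
Qed.

(** A maximum is below [e] exactly when both terms are, so the max-distance induces the product
    uniform structure already in place. *)
Fact ball_prod_mdistE (z : X * Y) (e : R) :
  ball z e = [set w | prod_mdist z w < e].
Proof.
apply/seteqP; split => w; rewrite {1}/ball /= /prod_ball !ballEmdist /=
  /prod_mdist gt_max; first by move=> [-> ->].
by move/andP.
Qed.

HB.instance Definition _ := PseudoMetric_isMetric.Build R (X * Y)%type
  prod_mdist_ge0 prod_mdist_positivity ball_prod_mdistE.

Lemma prod_mdistE (z w : X * Y) :
  mdist z w = Num.max (mdist z.1 w.1) (mdist z.2 w.2).
Proof. by []. Qed.

End product_metric.

Section product_complete.
Context {R : realType} {X Y : completeMetricType R}.

(* The library declares no join of the pointed and the uniform structures on a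
   product; [Uniform_isComplete] needs it. *)
HB.instance Definition _ := Pointed.on (X * Y)%type.

(** Both projections of a Cauchy filter are Cauchy, and the pair of their limits is a limit of the
    filter. *)
Fact prod_cauchy_cvg (G : set_system (X * Y)) :
  ProperFilter G -> cauchy G -> cvg G.
Proof.
move=> GG /cauchyP Gc.
have cfst : cauchy (fst @ G).
  by apply/cauchyP => e /Gc[z Gz]; exists z.1; apply: (@filterS _ G) Gz => w [].
have csnd : cauchy (snd @ G).
  by apply/cauchyP => e /Gc[z Gz]; exists z.2; apply: (@filterS _ G) Gz => w [].
have /cvg_ex[x Gx] : cvg (fst @ G) by exact/cauchy_cvgP.
have /cvg_ex[y Gy] : cvg (snd @ G) by exact/cauchy_cvgP.
apply/cvg_ex; exists (x, y); apply/fcvg_ballP => e e0.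
move: Gx Gy => /cvg_ballP/(_ e e0) Gx /cvg_ballP/(_ e e0) Gy.
by apply: (@filterS2 _ G) Gx Gy => w.
Qed.

HB.instance Definition _ :=
  Uniform_isComplete.Build (X * Y)%type prod_cauchy_cvg.

End product_complete.

(** * Bounds from upper and lower limits *)

(** The upper limit is an infimum of suprema over members of the filter; [c] is one of these
    suprema. It later separates [phi] from [psi]. *)
Lemma limf_esup_lt {T : choiceType} {U : filteredType T} {R : realType}
    {f : U -> \bar R} {F : set_system U} {FF : Filter F} {a : \bar R} :
  (limf_esup f F < a)%E ->
  exists2 c, (c < a)%E & \forall x \near F, (f x <= c)%E.
Proof.
rewrite limf_esupE => /ereal_inf_lt[c [A FA <-] lta].
exists (ereal_sup (f @` A)) => //.
by apply: filterS FA => x Ax; apply: ereal_sup_ubound; exists x.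
Qed.

Lemma limf_einf_gt {T : choiceType} {U : filteredType T} {R : realType}
    {f : U -> \bar R} {F : set_system U} {FF : Filter F} {a : \bar R} :
  (a < limf_einf f F)%E -> \forall x \near F, (a < f x)%E.
Proof.
rewrite limf_einfE => /ereal_sup_gt[_ [A FA <-] lta].
apply: filterS FA => x Ax; apply: lt_le_trans lta _.
by apply: ereal_inf_lbound; exists x.
Qed.

(** * Orbits of a single map *)

(** The values [psi (t n)] decrease. If they are bounded below, (iii) applies; otherwise they fall
    below every value of [psi] on a half-line [t > e], by (ii). *)
Lemma decreasing_psi_cvg0 {R : realType} (psi phi : R -> R)
    (hi : forall t, 0 < t -> phi t < psi t)
    (hii : forall eps : R, 0 < eps ->
       (-oo < ereal_inf [set (psi t)%:E | t in [set t : R | (eps < t)%R]])%E)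
    (hiii : forall t : nat -> R, (forall n, 0 < t n) ->
       (exists l : R, psi (t n) @[n --> \oo] --> l /\
                      phi (t n) @[n --> \oo] --> l) ->
       (forall n, psi (t n.+1) < psi (t n)) ->
       t n @[n --> \oo] --> (0 : R))
    (t : nat -> R) :
  (forall n, 0 < t n) -> (forall n, psi (t n.+1) <= phi (t n)) ->
  t n @[n --> \oo] --> (0 : R).
Proof.
move=> t0 tS.
have psi_lt n : psi (t n.+1) < psi (t n) by apply: le_lt_trans (tS n) (hi _ _).
have psi_ni : {homo (psi \o t) : n m / (n <= m)%N >-> m <= n}.
  by apply/nonincreasing_seqP => n; exact: ltW (psi_lt n).
have [lb|nlb] := pselect (has_lbound (range (psi \o t))).
  apply: hiii => //; exists (inf (range (psi \o t))).
  have psi_cvg := nonincreasing_cvgn psi_ni lb; split => //.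
  (* [phi (t n)] lies between [psi (t n.+1)] and [psi (t n)]. *)
  apply: (squeeze_cvgr (f := fun n => psi (t n.+1)) (h := psi \o t)) => //.
    by apply: nearW => n /=; rewrite tS ltW// hi.
  by rewrite (cvg_shiftS (psi \o t)).
apply/cvgr0Pnorm_le => e e0.
(* Otherwise the infimum of [psi] beyond [e], finite by (ii), would bound all [psi (t n)] from
   below. *)
have [N psiN] : exists N, forall s, e < s -> psi (t N) < psi s.
  apply: contra_notP nlb => /forallNP h.
  have := hii e e0; set m := ereal_inf _ => m_gt.
  have le_psi s : e < s -> (m <= (psi s)%:E)%E.
    by move=> es; apply: ereal_inf_lbound; exists s.
  have m_fin : m \is a fin_num.
    rewrite fin_real// m_gt /= (le_lt_trans (le_psi (e + 1) _)) ?ltry//.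
    by rewrite ltrDl.
  exists (fine m) => _ [n _ <-] /=.
  have /existsNP[s /not_implyP[es /negP]] := h n.
  rewrite -leNgt; apply: le_trans.
  by rewrite -lee_fin fineK// le_psi.
exists N => // n /= Nn; rewrite gtr0_norm// leNgt; apply/negP => /psiN.
by rewrite ltNge psi_ni.
Qed.

(** The one-map form of the condition, to be applied to the pair map on the product. *)
Definition psi_phi_contraction {R : realType} {Z : metricType R}
    (psi phi : R -> R) (F : Z -> Z) : Prop :=
  forall z w, 0 < mdist (F z) (F w) ->
    psi (mdist (F z) (F w)) <= phi (mdist z w).

(** Either the distances stay positive and satisfy the recursion of [decreasing_psi_cvg0], or the
    orbits meet and coincide from then on. *)
Lemma iter_mdist_cvg0 {R : realType} {Z : metricType R} (psi phi : R -> R)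
    (F : Z -> Z) (hF : psi_phi_contraction psi phi F)
    (hi : forall t, 0 < t -> phi t < psi t)
    (hii : forall eps : R, 0 < eps ->
       (-oo < ereal_inf [set (psi t)%:E | t in [set t : R | (eps < t)%R]])%E)
    (hiii : forall t : nat -> R, (forall n, 0 < t n) ->
       (exists l : R, psi (t n) @[n --> \oo] --> l /\
                      phi (t n) @[n --> \oo] --> l) ->
       (forall n, psi (t n.+1) < psi (t n)) ->
       t n @[n --> \oo] --> (0 : R)) (z w : Z) :
  mdist (iter n F z) (iter n F w) @[n --> \oo] --> (0 : R).
Proof.
have [pos|/existsNP[N]] :=
  pselect (forall n, 0 < mdist (iter n F z) (iter n F w)).
  apply: (decreasing_psi_cvg0 _ _ hi hii hiii _ pos) => n.
  exact: hF (pos n.+1).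
move/negP; rewrite mdist_gt0 negbK => /eqP zw.
apply: cvg_near_cst; exists N => // n /= /subnK <-.
by rewrite !iterD zw mdistxx.
Qed.

Lemma iter_cauchy {R : realType} {Z : metricType R} (psi phi : R -> R)
    (F : Z -> Z) (hF : psi_phi_contraction psi phi F)
    (hiv : forall eps : R, 0 < eps ->
       (limf_esup (EFin \o phi) eps^'+ < limf_einf (EFin \o psi) eps^'+)%E)
    (hF0 : forall z w : Z,
       mdist (iter n F z) (iter n F w) @[n --> \oo] --> (0 : R)) (z : Z) :
  cauchy_ex (iter n F z @[n --> \oo]).
Proof.
move=> e e0; apply: contrapT => /forallNP noball.
pose eps := e / 2; have eps0 : 0 < eps by rewrite divr_gt0.
have [c ltc phi_le] := limf_esup_lt (hiv _ eps0).
have [d /= d0 psi_phi] := filterI phi_le (limf_einf_gt ltc).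
pose eta := Num.min d eps / 4.
have eta0 : 0 < eta by rewrite divr_gt0// lt_min d0.
have etad : 4 * eta <= d by rewrite mulrC divfK// ge_min lexx.
have etae : 4 * eta <= eps by rewrite mulrC divfK// ge_min lexx orbT.
(* The orbits of [z] and [F z] differ by a shift, so consecutive terms become close. *)
have /cvgr0Pnorm_lt/(_ (eta / 2))[] := hF0 z (F z).
  by rewrite divr_gt0.
move=> N _ small.
have {}small n : (N <= n)%N -> mdist (iter n F z) (iter n.+1 F z) < eta / 2.
  by move=> /small /=; rewrite ger0_norm ?mdist_ge0// -iterSr.
have /existsNP[m /not_implyP[/= Nm]] : ~ forall m, (N <= m)%N ->
    mdist (iter N F z) (iter m F z) < e.
  move=> h; apply: (noball (iter N F z)).
  by exists N => // m Nm; rewrite ballEmdist; exact: h.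
move/negP; rewrite -leNgt => far.
pose a k := mdist (iter (k + N) F z) (iter (k + m) F z).
(* Each of the two points moves by less than [eta / 2]. *)
have a_step k : a k < a k.+1 + eta /\ a k.+1 < a k + eta.
  have h1 := small _ (leq_addl k N).
  have h2 := small _ (leq_trans Nm (leq_addl k m)).
  rewrite /a !addSn.
  set x := iter _ F z in h1 *; set y := iter _.+1 F z in h1 *.
  set u := iter _ F z in h2 *; set v := iter _.+1 F z in h2 *.
  have := metric_triangle x y u; have := metric_triangle y v u.
  have := metric_triangle y x v; have := metric_triangle x u v.
  rewrite (metric_sym v u) (metric_sym y x).
  by move=> t1 t2 t3 t4; split; lra.
(* The first [k] below this level is positive, since [a 0 >= 2 * eps >= eps + 4 * eta]. *)
have /ex_minnP[k a_k k_min] : exists k, a k <= eps + 2 * eta.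
  have /cvgr0Pnorm_lt/(_ _ eta0)[K _ /(_ K (leqnn K))/=] :=
    hF0 (iter N F z) (iter m F z).
  rewrite -!iterD ger0_norm ?mdist_ge0// => aK; exists K.
  by apply/ltW/(lt_trans aK); lra.
case: k => [|k] in a_k k_min; first by rewrite /a !add0n /eps in a_k etae; lra.
have ak : eps + 2 * eta < a k.
  by rewrite ltNge; apply/negP => /k_min; rewrite ltnn.
have [ak1 _] := a_step k; have [ak2 ak2'] := a_step k.+1.
(* After the case split, [a k.+1] is in [(eps + eta, eps + 2 * eta]], so [a k.+2] is in
   [(eps, eps + 3 * eta)], within [d] of [eps]. *)
have inball s : eps < s -> s < eps + 3 * eta ->
    ((phi s)%:E <= c /\ c < (psi s)%:E)%E.
  move=> s1 s2; apply: psi_phi => //=.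
  by rewrite distrC gtr0_norm ?subr_gt0//; lra.
have [phik _] : ((phi (a k.+1))%:E <= c /\ c < (psi (a k.+1))%:E)%E.
  by apply: inball; lra.
have [_ psik] : ((phi (a k.+2))%:E <= c /\ c < (psi (a k.+2))%:E)%E.
  by apply: inball; lra.
have : psi (a k.+2) <= phi (a k.+1).
  by apply: hF; rewrite -!iterS -!addSn -/(a k.+2); lra.
by apply/negP; rewrite -ltNge -lte_fin (le_lt_trans phik).
Qed.

(** If [F xi] differs from [xi], a late orbit point [y] has [mdist y xi] near 0 and
    [mdist (F y) (F xi)] near [eps]; the bounds on [phi] and [psi] there contradict the
    contraction. *)
Lemma iter_lim_fixed {R : realType} {Z : metricType R} (psi phi : R -> R)
    (F : Z -> Z) (hF : psi_phi_contraction psi phi F)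
    (hv : forall eps : R, 0 < eps ->
       (limf_esup (EFin \o phi) (0 : R)^'+ <
        Order.min (lime_inf (EFin \o psi) eps) (psi eps)%:E)%E) (z xi : Z) :
  iter n F z @[n --> \oo] --> xi -> F xi = xi.
Proof.
move=> z_xi; apply/eqP; apply/negPn; rewrite eq_sym -mdist_gt0; apply/negP.
set eps := mdist _ _ => eps0.
have [c] := limf_esup_lt (hv _ eps0).
rewrite lt_min => /andP[/limf_einf_gt psi_gt psi_eps] [d /= d0 phi_le].
(* The lower limit ignores the point [eps] itself; the term [psi eps] of the minimum covers it. *)
have {psi_gt} [r /= r0 psi_gt] : \forall s \near eps, (c < (psi s)%:E)%E.
  move: psi_gt; rewrite /dnbhs near_withinE; apply: filterS => s /= h.
  by have [->//|/h] := eqVneq s eps.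
(* [d] serves [phi], [r] serves [psi], and [eps] keeps [F y] distinct from [F xi]. *)
pose e := Num.min (Num.min d r) eps.
have e0 : 0 < e by rewrite !lt_min d0 r0.
have /metricType_numDomainType.cvgrPdist_lt/(_ _ e0)[N _ close] := z_xi.
have {close} zxi n : (N <= n)%N -> mdist (iter n F z) xi < e.
  by move=> /close /=; rewrite metric_sym.
have zd : mdist (iter N F z) xi < e by exact: zxi.
have : mdist (F (iter N F z)) xi < e by rewrite -iterS zxi.
set y := iter N F z in zd *; rewrite !lt_min => /andP[/andP[_ yr] yeps].
have := metric_triangle xi (F y) (F xi).
have := metric_triangle (F y) xi (F xi).
rewrite (metric_sym xi (F y)) -/eps => tr1 tr2.
have Fy0 : 0 < mdist (F y) (F xi) by lra.
have y0 : 0 < mdist y xi.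
  by move: Fy0; rewrite !mdist_gt0; apply: contraNneq => ->.
have phic : ((phi (mdist y xi))%:E <= c)%E.
  apply: phi_le => //=; rewrite sub0r normrN gtr0_norm//.
  by move: zd; rewrite !lt_min => /andP[/andP[]].
have psic : (c < (psi (mdist (F y) (F xi)))%:E)%E.
  by apply: psi_gt => /=; rewrite ltr_norml; lra.
have := hF _ _ Fy0; apply/negP.
by rewrite -ltNge -lte_fin (le_lt_trans phic).
Qed.

Lemma psi_phi_contraction_fixed {R : realType} {Z : completeMetricType R}
    (psi phi : R -> R) (F : Z -> Z) (hF : psi_phi_contraction psi phi F)
    (hi : forall t, 0 < t -> phi t < psi t)
    (hii : forall eps : R, 0 < eps ->
       (-oo < ereal_inf [set (psi t)%:E | t in [set t : R | (eps < t)%R]])%E)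
    (hiii : forall t : nat -> R, (forall n, 0 < t n) ->
       (exists l : R, psi (t n) @[n --> \oo] --> l /\
                      phi (t n) @[n --> \oo] --> l) ->
       (forall n, psi (t n.+1) < psi (t n)) ->
       t n @[n --> \oo] --> (0 : R))
    (hiv : forall eps : R, 0 < eps ->
       (limf_esup (EFin \o phi) eps^'+ < limf_einf (EFin \o psi) eps^'+)%E)
    (hv : (forall (z_ : nat -> Z) (z w : Z), z_ n @[n --> \oo] --> z ->
             F (z_ n) @[n --> \oo] --> w -> F z = w) \/
       (forall eps : R, 0 < eps ->
          (limf_esup (EFin \o phi) (0 : R)^'+ <
           Order.min (lime_inf (EFin \o psi) eps) (psi eps)%:E)%E)) :
  exists xi : Z, [/\ F xi = xi, forall z, F z = z -> z = xi
    & forall z, iter n F z @[n --> \oo] --> xi].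
Proof.
have hF0 := iter_mdist_cvg0 psi phi F hF hi hii hiii.
have /cauchy_exP/cauchy_cvgP/cvg_ex[xi pt_xi] :=
  iter_cauchy psi phi F hF hiv hF0 point.
have Fxi : F xi = xi.
  case: hv => [hclosed|hv]; last exact: (iter_lim_fixed psi phi F hF hv point).
  apply: (hclosed _ _ _ pt_xi).
  by rewrite (cvg_shiftS (fun n => iter n F point)).
(* The orbit of [xi] is constant, so every orbit, being asymptotic to it, tends to [xi]. *)
have iter_xi n : iter n F xi = xi by elim: n => //= n ->.
have z_xi z : iter n F z @[n --> \oo] --> xi.
  apply/metricType_numDomainType.cvgrPdist_lt => e e0.
  have /cvgr0Pnorm_lt/(_ _ e0) := hF0 xi z; apply: filterS => n.
  by rewrite iter_xi ger0_norm ?mdist_ge0.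
exists xi; split => // z Fz; apply/eqP; rewrite -[_ == _]negbK -mdist_gt0.
apply/negP => zxi0; have /cvgr0Pnorm_lt/(_ _ zxi0)[N _] := hF0 z xi.
have iter_z n : iter n F z = z by elim: n => //= n ->.
by move=> /(_ N (leqnn N)) /=; rewrite iter_z iter_xi gtr0_norm// ltxx.
Qed.

(** * From the pair map back to [T] and [S] *)

Lemma iter_pairE {X Y : Type} (T : X * Y -> X) (S : X * Y -> Y) (n : nat)
    (z : X * Y) :
  iter n (fun z => (T z, S z)) z = (Titer T S n z, Siter T S n z).
Proof. by elim: n => [|n /= ->] //; case: z. Qed.

(** The larger of the two image distances is positive, so its own inequality applies. *)
Lemma extended_jointly_contraction_pair {R : realType} {X Y : metricType R}
    (psi phi : R -> R) (T : X * Y -> X) (S : X * Y -> Y) :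
  extended_jointly_contraction psi phi T S ->
  psi_phi_contraction psi phi (fun z => (T z, S z)).
Proof.
move=> hTS z w F0; have [hT hS] := hTS z w F0.
move: F0; rewrite !prod_mdistE /=.
by case: (leP (mdist (T z) (T w)) (mdist (S z) (S w))).
Qed.

Theorem theorem3p2 (R : realType) (X Y : completeMetricType R)
    (T : X * Y -> X) (S : X * Y -> Y) (psi phi : R -> R)
    (hTS : extended_jointly_contraction psi phi T S)
    (hi : forall t : R, 0 < t -> phi t < psi t)
    (hii : forall eps : R, 0 < eps ->
       (-oo < ereal_inf [set (psi t)%:E | t in [set t : R | (eps < t)%R]])%E)
    (hiii : forall t : nat -> R, (forall n, 0 < t n) ->
       (exists l : R, psi (t n) @[n --> \oo] --> l /\
                      phi (t n) @[n --> \oo] --> l) ->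
       (forall n, psi (t n.+1) < psi (t n)) ->
       t n @[n --> \oo] --> (0 : R))
    (hiv : forall eps : R, 0 < eps ->
       (limf_esup (EFin \o phi) eps^'+ < limf_einf (EFin \o psi) eps^'+)%E)
    (hv : (closed_graph T /\ closed_graph S) \/
       (forall eps : R, 0 < eps ->
          (limf_esup (EFin \o phi) (0 : R)^'+ <
           Order.min (lime_inf (EFin \o psi) eps) (psi eps)%:E)%E)) :
  exists xi : X * Y,
    [/\ xi.1 = T xi /\ xi.2 = S xi,
        forall z : X * Y, z.1 = T z /\ z.2 = S z -> z = xi
      & forall z : X * Y,
          Titer T S n z @[n --> \oo] --> xi.1 /\
          Siter T S n z @[n --> \oo] --> xi.2].
Proof.
have hF := extended_jointly_contraction_pair psi phi T S hTS.
have [|xi [Fxi xi_uniq xi_lim]] :=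
    psi_phi_contraction_fixed psi phi (fun z => (T z, S z)) hF hi hii hiii hiv.
  case: hv => [[cT cS]|]; [left|by right].
  (* Closedness of the graph is checked coordinatewise, through the continuous projections. *)
  move=> z_ [x y] [a b] zxy Fab.
  have zx : (z_ n).1 @[n --> \oo] --> x.
    exact: (cvg_comp _ _ zxy cvg_fst).
  have zy : (z_ n).2 @[n --> \oo] --> y.
    exact: (cvg_comp _ _ zxy cvg_snd).
  have pairE n : ((z_ n).1, (z_ n).2) = z_ n by case: (z_ n).
  have Ta : T ((z_ n).1, (z_ n).2) @[n --> \oo] --> a.
    by under eq_fun do rewrite pairE; exact: (cvg_comp _ _ Fab cvg_fst).
  have Sb : S ((z_ n).1, (z_ n).2) @[n --> \oo] --> b.
    by under eq_fun do rewrite pairE; exact: (cvg_comp _ _ Fab cvg_snd).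
  by rewrite (cT _ _ _ _ _ zx zy Ta) (cS _ _ _ _ _ zx zy Sb).
exists xi; split.
- by rewrite -{1 3}Fxi.
- by case=> x y [/= xT yS]; apply: xi_uniq; rewrite -xT -yS.
move=> z; have := xi_lim z; under eq_fun do rewrite iter_pairE.
move=> lim_z; split.
  exact: (cvg_comp _ _ lim_z cvg_fst).
exact: (cvg_comp _ _ lim_z cvg_snd).
Qed.
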